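(* Let $\mu$ be a probability measure on $\mathbb{R}$ with bounded support, and let $$u(t,x) \,=\, \frac{\int z\,e^{-zx/2 + z^2t/4} \,d\mu(z)}{\int e^{-zx/2 + z^2t/4} \,d\mu(z)}\,, \qquad t \in \mathbb{R}\,, \quad x \in \mathbb{R}\,.$$ A real number $c \in \mathbb{R}$ belongs to $\mathrm{supp}(\mu)$ if and only if $u(t,\cdot+ct)$ converges to the constant $c$ in $L^\infty_{\mathrm{loc}}(\mathbb{R})$ as $t \to -\infty$.
   Context: Convergence in $L^\infty_{\mathrm{loc}}(\mathbb{R})$ means uniform convergence on every compact interval $[-R,R]$. The function $u$ is a bounded entire solution (defined for all $t\in\mathbb{R}$) of Burgers' equation $\partial_t u+u\,\partial_x u=\partial_x^2 u$. $\mathrm{supp}(\mu)$ denotes the (closed) support of $\mu$. *)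

(* Defs.v *)
From HB Require Import structures.
From mathcomp Require Import all_boot all_order all_algebra.
From mathcomp Require Import all_classical all_reals all_analysis.
Import Order.TTheory GRing.Theory Num.Theory.
Import numFieldNormedType.Exports.

Set Implicit Arguments.
Unset Strict Implicit.
Unset Printing Implicit Defensive.

Local Open Scope classical_set_scope.
Local Open Scope ring_scope.

Definition measure_supp (R : realType) (mu : probability R R) : set R :=
  [set x | forall U : set R, open U -> U x -> (0 < mu U)%E].

Definition burgers_sol (R : realType) (mu : probability R R) (t x : R) : R :=
  (\int[mu]_z (z * expR (- z * x / 2 + z ^+ 2 * t / 4))) /
  (\int[mu]_z expR (- z * x / 2 + z ^+ 2 * t / 4)).

(* Convergence in L^oo_loc, i.e. uniform convergence on every [-r, r], along
   the filter [F] on functions. *)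
Definition cvg_Linfty_loc (R : realType) (F : set_system (R -> R))
    (g : R -> R) : Prop :=
  forall r : R, 0 < r -> {uniform `[- r, r], F --> g}.

(* Main.v *)
Require Import Defs.
From mathcomp Require Import all_boot all_order all_algebra.
From mathcomp Require Import all_classical all_reals all_analysis.
From mathcomp Require Import measurable_realfun ring lra.
Import Order.TTheory GRing.Theory Num.Theory.
Import numFieldNormedType.Exports.

Local Open Scope classical_set_scope.
Local Open Scope ring_scope.

(** For every bounded measurable set [A] of full measure, the substitution
[x + c * t] for [x] turns the solution into a ratio of integrals over [A]:
[[
u(t, x + c t) - c = N / W,
  W = \int_A exp(- (z - c) x / 2 + (z - c)^2 t / 4) dmu(z),
  N = \int_A (z - c) exp(- (z - c) x / 2 + (z - c)^2 t / 4) dmu(z),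
]]
because completing the square produces a factor independent of [z], which
cancels in the quotient ([burgers_sol_shift]).  When [t] tends to [-oo] the
Gaussian factor concentrates the weight on the points of the support that are
closest to [c].

If [c] is in the support, the part [|z - c| > e / 2] of the integral contributes
at most a constant times [exp((e/2)^2 t / 4)]
([norm_mul_burgers_weight_le]), whereas the ball of radius [e / 4] around
[c], which has positive measure, already gives to [W] at least a
constant times [exp((e/4)^2 t / 4)] ([Rintegral_burgers_weight_ge]).  Hence
[|N| < e W] for [t] close to [-oo], uniformly for bounded [x]
([burgers_sol_supp]).

If [c] is not in the support, [A] can be chosen to avoid a ball of radius [d]
around [c].  The quotient need not have a limit in that case, so two
positions are compared at a fixed time.  At [x = -2] and [x = 2] the weights
are [exp(z - c)] and [exp(c - z)] times a common factor, and
[y (exp(y) - exp(-y)) >= k (exp(y) + exp(-y))] whenever [|y| >= d], with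
[k = d^2 / (1 + d)] ([mul_expR_antisym_ge]).  Integrating,
[N(-2) - N(2) >= k (W(-2) + W(2))], so [|u - c|] is at least [k] at one of the
two positions, for every [t] ([burgers_sol_gap]), and uniform convergence to
[c] on the interval from -2 to 2 fails. *)

(** * The support carries the measure *)

(** The real line has a countable base of intervals with rational endpoints,
and each point outside the support lies in a null interval of that base. *)
Lemma measure_supp_setC {R : realType} (mu : probability R R) :
  mu.-negligible (~` measure_supp mu).
Proof.
pose J (p : rat * rat) : set R := `]ratr p.1, ratr p.2[%classic.
pose F k : set R := if unpickle k is Some p then
  (if mu (J p) == 0%E then J p else set0) else set0.
apply: (@negligibleS _ _ _ _ (\bigcup_k F k)).
  move=> x /= /existsNP[U /not_implyP[oU /not_implyP[Ux /negP]]].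
  rewrite -leNgt => muU.
  have /nbhs_ballP[e /= e0 xeU] : nbhs x U by exact: open_nbhs_nbhs.
  have /rat_in_itvoo[a] : x - e < x by rewrite ltrBlDr ltrDl.
  have /rat_in_itvoo[b] : x < x + e by rewrite ltrDl.
  rewrite !in_itv/= => /andP[xb be] /andP[ea ax].
  have JU : J (a, b) `<=` U.
    move=> y; rewrite /J/= in_itv/= => /andP[ay yb]; apply: xeU.
    by rewrite /ball/= ltr_distlC; apply/andP; split; lra.
  have muJ : mu (J (a, b)) = 0%E.
    apply/eqP; rewrite -measure_le0; apply: le_trans muU.
    apply: le_measure; rewrite ?inE//; last exact: open_measurable.
    exact: measurable_itv.
  exists (pickle (a, b)); first exact: I.
  by rewrite /F pickleK muJ eqxx /J/= in_itv/= ax xb.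
apply: negligible_bigcup => k; rewrite /F.
case: unpickle => [p|]; last exact: negligible_set0.
case: ifPn => [/eqP p0|_]; last exact: negligible_set0.
by apply/negligibleP => //; exact: measurable_itv.
Qed.

(** * Integrals over a bounded set of full measure *)

Section conull.
Context {R : realType} (mu : probability R R) {M : R} {A : set R}
  (mA : measurable A) (AM : A `<=` `[- M, M]) (A1 : mu (~` A) = 0%E).

Lemma continuous_integrable (f : R -> R) (B : set R) :
  measurable B -> B `<=` `[- M, M] -> continuous f ->
  mu.-integrable B (EFin \o f).
Proof.
move=> mB BM cf; apply: measurable_bounded_integrable => //.
- exact: (le_lt_trans (probability_le1 _ _) (ltry _)).
- apply: (measurable_funS measurableT) => //; exact: continuous_measurable_fun.
- have /compact_bounded[N [_ Nf]] :
    compact (f @` `[- M, M]).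
    apply: continuous_compact; last exact: segment_compact.
    exact: continuous_subspaceT.
  exists N; split; rewrite ?num_real// => n Nn x /BM Bx.
  by apply: Nf => //; exists x.
Qed.

Lemma conull_integrable (f : R -> R) : continuous f ->
  mu.-integrable A (EFin \o f).
Proof. exact: continuous_integrable. Qed.

Lemma Rintegral_conull (f : R -> R) : continuous f ->
  \int[mu]_z f z = \int[mu]_(z in A) f z.
Proof.
move=> cf; rewrite /Rintegral; congr fine.
rewrite (@negligible_integral _ _ _ _ _ (~` A))//.
- by rewrite setDE setCK setTI.
- exact: measurableC.
- rewrite (@negligible_integrable _ _ _ mu _ (~` A))//.
  + by rewrite setDE setCK setTI; exact: conull_integrable.
  + exact: measurableC.
    by apply/measurable_EFinP; exact: continuous_measurable_fun.
Qed.

Lemma conull_measure : mu A = 1%E.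
Proof.
have := probability_setC mu (measurableC mA).
by rewrite setCK A1 sube0.
Qed.

Lemma measure_conullI (B : set R) : measurable B -> mu (A `&` B) = mu B.
Proof.
move=> mB; have mCA := measurableC mA.
rewrite [A `&` B]setIC -[in RHS](setIT B) -(setUv A) setIUr measureU0//.
- exact: measurableI.
- exact: measurableI.
- by apply: subset_measure0 A1; [exact: measurableI| |exact: subIsetr].
Qed.

Lemma Rintegral_conull_cst (k : R) : \int[mu]_(z in A) k = k.
Proof.
rewrite -[RHS]mulr1 -[X in _ * X]/(fine 1) -conull_measure.
exact: Rintegral_cst.
Qed.

(** A positive lower bound of [f] on [A] comes from its minimum on the compact
interval containing [A]. *)
Lemma Rintegral_conull_gt0 (f : R -> R) : continuous f ->
  (forall z, 0 < f z) -> 0 < \int[mu]_(z in A) f z.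
Proof.
move=> cf f0.
have [x Ax] : A !=set0.
  apply/set0P/eqP => A0; move: conull_measure.
  by rewrite A0 measure0 => /esym/eqP; rewrite onee_eq0.
have MM : - M <= M.
  by have := AM _ Ax; rewrite /= in_itv/= => /andP[]; exact: le_trans.
have [y _ fy] := EVT_min MM (continuous_subspaceT cf).
apply: (lt_le_trans (f0 y)).
rewrite -[leLHS]Rintegral_conull_cst; apply: le_Rintegral => //.
- apply: conull_integrable; exact: cst_continuous.
- exact: conull_integrable.
- by move=> z /AM; exact: fy.
Qed.

End conull.

(** * The solution in the moving frame *)

Definition burgers_weight {R : realType} (c t x z : R) : R :=
  expR (- (z - c) * x / 2 + (z - c) ^+ 2 * t / 4).

Lemma continuous_burgers_weight {R : realType} (c t x : R) :
  continuous (burgers_weight c t x).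
Proof.
move=> z; apply: (@continuous_comp _ _ _
  (fun z => - (z - c) * x / 2 + (z - c) ^+ 2 * t / 4) expR);
  last exact: continuous_expR.
apply: cvgD.
  apply: cvgMr_tmp; apply: cvgMr_tmp; apply: cvgN.
  by apply: cvgB; [exact: cvg_id|exact: cvg_cst].
apply: cvgMr_tmp; apply: cvgMr_tmp; rewrite /GRing.exp/=.
by apply: cvgM; apply: cvgB; (exact: cvg_id||exact: cvg_cst).
Qed.

Lemma continuous_mul_burgers_weight {R : realType} (c t x : R) :
  continuous (fun z => (z - c) * burgers_weight c t x z).
Proof.
move=> z; apply: cvgM; last exact: continuous_burgers_weight.
by apply: cvgB; [exact: cvg_id|exact: cvg_cst].
Qed.

Lemma burgers_weight_gt0 {R : realType} (c t x z : R) :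
  0 < burgers_weight c t x z.
Proof. exact: expR_gt0. Qed.
#[local] Hint Resolve continuous_burgers_weight continuous_mul_burgers_weight
  burgers_weight_gt0 : core.

(** Completing the square gives
[- z (x + c t) / 2 + z^2 t / 4 = - (z - c) x / 2 + (z - c)^2 t / 4 - K] with
[K = c x / 2 + c^2 t / 4], so the factor [exp(- K)] is common to the numerator
and the denominator. *)
Lemma burgers_sol_shift {R : realType} (mu : probability R R) (M : R)
    (A : set R) (c t x : R) : measurable A -> A `<=` `[- M, M] ->
    mu (~` A) = 0%E ->
  (burgers_sol mu t (x + c * t) - c) *
    \int[mu]_(z in A) burgers_weight c t x z =
  \int[mu]_(z in A) ((z - c) * burgers_weight c t x z).
Proof.
move=> mA AM A1.
set k := expR (- (c * x / 2 + c ^+ 2 * t / 4)).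
have wE z : expR (- z * (x + c * t) / 2 + z ^+ 2 * t / 4) =
            k * burgers_weight c t x z.
  by rewrite /k -expRD; congr expR; field.
have iw := conull_integrable mu mA AM _ (continuous_burgers_weight c t x).
have iy := conull_integrable mu mA AM _ (continuous_mul_burgers_weight c t x).
have ic : mu.-integrable A (EFin \o (fun z => c * burgers_weight c t x z)).
  apply: (conull_integrable mu mA AM) => z; apply: cvgMl_tmp.
  exact: continuous_burgers_weight.
have W0 : 0 < \int[mu]_(z in A) burgers_weight c t x z.
  exact: (Rintegral_conull_gt0 mu mA AM).
rewrite /burgers_sol.
have -> : \int[mu]_z expR (- z * (x + c * t) / 2 + z ^+ 2 * t / 4) =
    k * \int[mu]_(z in A) burgers_weight c t x z.
  under eq_Rintegral do rewrite wE.
  rewrite (Rintegral_conull mu mA AM)//; first by rewrite RintegralZl.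
  by move=> z; apply: cvgMl_tmp; exact: continuous_burgers_weight.
have -> : \int[mu]_z (z * expR (- z * (x + c * t) / 2 + z ^+ 2 * t / 4)) =
    k * (\int[mu]_(z in A) ((z - c) * burgers_weight c t x z) +
         c * \int[mu]_(z in A) burgers_weight c t x z).
  under eq_Rintegral do rewrite wE mulrCA.
  rewrite (Rintegral_conull mu mA AM); last 2 first.
    - by [].
    - move=> z; apply: cvgMl_tmp; apply: cvgM; first exact: cvg_id.
      exact: continuous_burgers_weight.
  rewrite -RintegralZl// -RintegralD// -RintegralZl//; last first.
    apply: (conull_integrable mu mA AM) => z; apply: cvgD.
      exact: continuous_mul_burgers_weight.
    by apply: cvgMl_tmp; exact: continuous_burgers_weight.
  by apply: eq_Rintegral => z _; ring.
by field; rewrite !gt_eqF ?expR_gt0.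
Qed.

(** * Outside the support *)

(** Both sides are even in [y].  For [y >= d] the estimate
[exp(2 y) >= 1 + 2 d] gives [exp(y) >= (1 + 2 d) exp(- y)], which is the bound
[tanh y >= d / (1 + d)]. *)
Lemma mul_expR_antisym_ge {R : realType} (d y : R) : 0 < d -> d <= `|y| ->
  d ^+ 2 / (1 + d) * (expR y + expR (- y)) <= y * (expR y - expR (- y)).
Proof.
move=> d0; wlog y0 : y / 0 <= y => [wlg dy|].
  have [y0|y0] := leP 0 y; first exact: wlg.
  have := wlg (- y); rewrite oppr_ge0 normrN opprK => /(_ (ltW y0) dy).
  by rewrite (addrC (expR (- y))) mulNr -mulrN opprB.
rewrite ger0_norm// => dy.
have q0 : 0 < expR (- y) := expR_gt0 _.
have pq : (1 + 2 * d) * expR (- y) <= expR y.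
  have -> : expR y = expR (2 * y) * expR (- y).
    by rewrite -expRD; congr expR; ring.
  rewrite ler_pM2r//; apply: le_trans (expR_ge1Dx _); lra.
rewrite mulrAC ler_pdivrMr; last by lra.
move: pq q0; move: (expR y) (expR (- y)) => p q pq q0.
have -> : d ^+ 2 * (p + q) = d * (d * (p + q)) by ring.
rewrite -mulrA; apply: ler_pM; nra.
Qed.

(** A quantitative form of the fact that, when [mu] has no mass near [c], the
solution cannot stay close to [c] on an interval: its slope is, up to a factor
[- 1 / 2], the variance of the weighted measure.  Integrating the elementary
inequality for [z - c] replaces the differentiation under the integral. *)
Lemma burgers_sol_gap {R : realType} (mu : probability R R) (M : R)
    (A : set R) (c d t : R) : measurable A -> A `<=` `[- M, M] ->
    mu (~` A) = 0%E -> 0 < d -> (forall z, A z -> d <= `|z - c|) ->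
    `|burgers_sol mu t (2 + c * t) - c| < d ^+ 2 / (1 + d) ->
  d ^+ 2 / (1 + d) <= `|burgers_sol mu t (- 2 + c * t) - c|.
Proof.
move=> mA AM A1 d0 dA; set k := d ^+ 2 / (1 + d) => u2.
rewrite leNgt; apply/negP => u2'.
have iw x := conull_integrable mu mA AM _ (continuous_burgers_weight c t x).
have iy x := conull_integrable mu mA AM _ (continuous_mul_burgers_weight c t x).
have W0 x : 0 < \int[mu]_(z in A) burgers_weight c t x z.
  exact: (Rintegral_conull_gt0 mu mA AM).
have Np := burgers_sol_shift mu M A c t 2 mA AM A1.
have Nm := burgers_sol_shift mu M A c t (- 2) mA AM A1.
have : k * (\int[mu]_(z in A) burgers_weight c t (- 2) z +
            \int[mu]_(z in A) burgers_weight c t 2 z) <=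
  \int[mu]_(z in A) ((z - c) * burgers_weight c t (- 2) z) -
  \int[mu]_(z in A) ((z - c) * burgers_weight c t 2 z).
  rewrite -RintegralD// -RintegralZl//; last first.
    apply: (conull_integrable mu mA AM) => z.
    by apply: cvgD; exact: continuous_burgers_weight.
  rewrite -RintegralB//; apply: le_Rintegral => //.
  - apply: (conull_integrable mu mA AM) => z; apply: cvgMl_tmp.
    by apply: cvgD; exact: continuous_burgers_weight.
  - apply: (conull_integrable mu mA AM) => z.
    by apply: cvgB; exact: continuous_mul_burgers_weight.
  - move=> z Az; have := mul_expR_antisym_ge _ _ d0 (dA _ Az).
    have -> : burgers_weight c t (- 2) z =
        expR (z - c) * expR ((z - c) ^+ 2 * t / 4).
      by rewrite -expRD; congr expR; field.
    have -> : burgers_weight c t 2 z =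
        expR (- (z - c)) * expR ((z - c) ^+ 2 * t / 4).
      by rewrite -expRD; congr expR; field.
    move/(ler_wpM2r (expR_ge0 ((z - c) ^+ 2 * t / 4))).
    by congr (_ <= _); rewrite /k; ring.
rewrite -Np -Nm => H.
move: u2 u2' H (W0 2) (W0 (- 2)); rewrite !ltr_norml.
move: (burgers_sol _ _ _ - c) (burgers_sol _ _ _ - c).
move: (Rintegral _ _ _) (Rintegral _ _ _).
move=> W W' a b /andP[a1 a2] /andP[b1 b2]; nra.
Qed.

(** * On the support *)

(** Only the mass within [h] of [c] is counted; there the weight is at least its
value for the extreme data [|z - c| = h] and [|x| = r]. *)
Lemma Rintegral_burgers_weight_ge {R : realType} (mu : probability R R) (M : R)
    (A : set R) (c r t x h : R) : measurable A -> A `<=` `[- M, M] ->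
    t <= 0 -> 0 <= h -> `|x| <= r ->
  expR (- (h * r / 2)) * expR (h ^+ 2 * t / 4) *
    fine (mu (A `&` `]c - h, c + h[%classic)) <=
  \int[mu]_(z in A) burgers_weight c t x z.
Proof.
move=> mA AM t0 h0 xr; set B := _ `&` _.
have mB : measurable B by apply: measurableI => //; exact: measurable_itv.
have iw := conull_integrable mu mA AM _ (continuous_burgers_weight c t x).
have BA : B `<=` A by exact: subIsetl.
have iB : mu.-integrable B (EFin \o burgers_weight c t x).
  by apply: integrableS iw.
rewrite -Rintegral_cst//.
apply: (@le_trans _ _ (\int[mu]_(z in B) burgers_weight c t x z)); last first.
  rewrite /Rintegral; apply: fine_le.
  - exact: integrable_fin_num iB.
  - exact: integrable_fin_num iw.
  - apply: ge0_subset_integral => //.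
    + exact: (measurable_int mu iw).
    + by move=> z _; rewrite /= lee_fin; exact/ltW/burgers_weight_gt0.
apply: le_Rintegral => //.
  apply: (continuous_integrable mu (M := M)) => //.
    exact: (subset_trans BA).
  exact: cst_continuous.
move=> z [_]; rewrite /= in_itv/= => /andP[hz zh].
rewrite -expRD ler_expR.
have zc : `|z - c| <= h by rewrite ler_norml; lra.
have : `|(z - c) * x| <= h * r by rewrite normrM ler_pM.
rewrite ler_norml => /andP[_ h1].
have : (z - c) ^+ 2 * - t <= h ^+ 2 * - t.
  rewrite ler_wpM2r ?oppr_ge0// -(real_normK (num_real (z - c))).
  by rewrite ler_pXn2r.
by lra.
Qed.

(** The first summand bounds the left-hand side when [|z - c| <= e], the second
one when [e < |z - c| <= L].  The second does not depend on [z] and, for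
[e > 0], decays when [t] tends to [-oo]. *)
Lemma norm_mul_burgers_weight_le {R : realType} (c t x z e r L : R) :
  t <= 0 -> 0 <= e -> `|z - c| <= L -> `|x| <= r ->
  `|z - c| * burgers_weight c t x z <=
  e * burgers_weight c t x z + L * expR (L * r / 2) * expR (e ^+ 2 * t / 4).
Proof.
move=> t0 e0 zL xr; have L0 := le_trans (normr_ge0 _) zL.
have [ze|ez] := leP `|z - c| e.
  rewrite -[leLHS]addr0 lerD//; first by rewrite ler_wpM2r ?expR_ge0.
  by rewrite !mulr_ge0 ?expR_ge0.
rewrite -[leLHS]add0r lerD//; first by rewrite mulr_ge0 ?expR_ge0.
rewrite -mulrA ler_pM ?expR_ge0// -expRD ler_expR.
have : `|(z - c) * x| <= L * r by rewrite normrM ler_pM.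
rewrite ler_norml => /andP[h1 _].
have : e ^+ 2 * - t <= (z - c) ^+ 2 * - t.
  rewrite ler_wpM2r ?oppr_ge0// -(real_normK (num_real (z - c))).
  by rewrite ler_pXn2r// ltW.
by lra.
Qed.

(** Cutting at radius [e / 2] and collecting the mass within [h = e / 4] makes
the decay rate of the remainder exceed that of the total weight by
[q = ((e / 2)^2 - h^2) / 4]. *)
Lemma burgers_sol_supp {R : realType} (mu : probability R R) (M c r e : R) :
  mu (~` `[- M, M]) = 0%E -> measure_supp mu c -> 0 < e ->
  exists T, forall t x, t < T -> `|x| <= r ->
    `|burgers_sol mu t (x + c * t) - c| < e.
Proof.
move=> M1 suppc e0; set A : set R := `[- M, M]%classic.
have mA : measurable A by exact: measurable_itv.
have AM : A `<=` `[- M, M] by [].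
pose L := `|M| + `|c|.
have AL z : A z -> `|z - c| <= L.
  rewrite /A /= in_itv/= => zM; apply: (le_trans (ler_normB _ _)).
  by rewrite lerD2r (le_trans _ (ler_norm _))// ler_norml.
have [h h0 he] : exists2 h, 0 < h & h = e / 4.
  by exists (e / 4); rewrite ?divr_gt0.
pose m := fine (mu (A `&` `]c - h, c + h[%classic)).
have m0 : 0 < m.
  rewrite /m (measure_conullI mu mA M1); last exact: measurable_itv.
  apply: fine_gt0; rewrite (le_lt_trans (probability_le1 _ _) (ltry _))// andbT.
  by apply: suppc; [exact: itv_open|rewrite /= in_itv/=; lra].
pose C1 := L * expR (L * r / 2).
pose C2 := h * expR (- (h * r / 2)) * m.
have L0 : 0 <= L by rewrite addr_ge0.
have C10 : 0 <= C1 by rewrite mulr_ge0 ?expR_ge0.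
have C20 : 0 < C2 by rewrite !mulr_gt0 ?expR_gt0.
pose q := (e / 2) ^+ 2 / 4 - h ^+ 2 / 4.
have q0 : 0 < q by rewrite /q he; nra.
(* Since [1 + y <= exp(y)], the bound [q * - t > C1 / C2] is enough to have
   [exp(q * - t) > C1 / C2]. *)
exists (- (C1 / C2 / q)) => t x tT xr.
have t0 : t <= 0.
  by apply: (le_trans (ltW tT)); rewrite oppr_le0 !divr_ge0// ltW.
have e20 : 0 <= e / 2 by lra.
have iw := conull_integrable mu mA AM _ (continuous_burgers_weight c t x).
have iy := conull_integrable mu mA AM _ (continuous_mul_burgers_weight c t x).
have W0 : 0 < \int[mu]_(z in A) burgers_weight c t x z.
  exact: (Rintegral_conull_gt0 mu mA AM).
set W := Rintegral _ _ _ in W0.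
have key : C1 * expR ((e / 2) ^+ 2 * t / 4) < h * W.
  apply: (@lt_le_trans _ _ (C2 * expR (h ^+ 2 * t / 4))); last first.
    have := Rintegral_burgers_weight_ge mu M A c r t x h mA AM t0 (ltW h0) xr.
    rewrite -/m -/W => /(ler_wpM2l (ltW h0)); congr (_ <= _).
    by rewrite /C2; ring.
  have -> : expR (h ^+ 2 * t / 4) =
      expR (q * - t) * expR ((e / 2) ^+ 2 * t / 4).
    by rewrite -expRD; congr expR; rewrite /q; ring.
  rewrite mulrA ltr_pM2r ?expR_gt0// -ltr_pdivrMl// mulrC.
  apply: (lt_le_trans _ (expR_ge1Dx _)).
  by move: tT; rewrite ltrNr (ltr_pdivrMr _ _ q0); lra.
have icst (a : R) : mu.-integrable A (EFin \o cst a).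
  apply: (conull_integrable mu mA AM); exact: cst_continuous.
have iew : mu.-integrable A (EFin \o (fun z => e / 2 * burgers_weight c t x z)).
  apply: (conull_integrable mu mA AM) => z; apply: cvgMl_tmp.
  exact: continuous_burgers_weight.
have H : `|(burgers_sol mu t (x + c * t) - c) * W| <=
    e / 2 * W + C1 * expR ((e / 2) ^+ 2 * t / 4).
  rewrite (burgers_sol_shift mu M A)//.
  have H1 := le_normr_Rintegral mA iy.
  apply: (le_trans H1).
  set k := C1 * _; have -> : k = \int[mu]_(z in A) k.
    by rewrite (Rintegral_conull_cst mu mA M1).
  rewrite /W -RintegralZl// -RintegralD//; last exact: icst.
  apply: le_Rintegral => //.
  - exact: integrable_norm iy.
  - apply: (conull_integrable mu mA AM) => z; apply: cvgD; last exact: cvg_cst.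
    by apply: cvgMl_tmp; exact: continuous_burgers_weight.
  - move=> z /AL zL; rewrite normrM (gtr0_norm (burgers_weight_gt0 _ _ _ _)).
    exact: norm_mul_burgers_weight_le.
move: H; rewrite normrM (gtr0_norm W0) => H.
rewrite -(ltr_pM2r W0); apply: (le_lt_trans H).
have : 0 < e * W by rewrite mulr_gt0.
by move: key; rewrite he; lra.
Qed.

(** * The characterization of the support *)

Theorem proposition1p2 (R : realType) (mu : probability R R)
    (hmu : bounded_set (measure_supp mu)) (c : R) :
  measure_supp mu c <->
  cvg_Linfty_loc
    ((fun t : R => fun x : R => burgers_sol mu t (x + c * t)) @ -oo) (cst c).
Proof.
have [M suppM] : exists M, mu (~` `[- M, M]) = 0%E.
  have [N [_ NS]] := hmu; exists (`|N| + 1).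
  apply/negligibleP; first by apply: measurableC; exact: measurable_itv.
  apply: negligibleS (measure_supp_setC mu); apply: subsetC => z /NS.
  move=> /(_ (`|N| + 1)); rewrite /= in_itv/= -ler_norml; apply.
  by rewrite ltr_pwDr// ler_norm.
have I2 : `[- 2, 2]%classic (2 : R) by rewrite /= in_itv/=; lra.
have I2' : `[- 2, 2]%classic (- 2 : R) by rewrite /= in_itv/=; lra.
split=> [suppc r r0|ucvg].
  move=> P /uniform_nbhs[E [entE EP]].
  move: entE; rewrite -entourage_ballE => -[e /= e0 eE].
  have [T Tu] := burgers_sol_supp mu M c r e suppM suppc e0.
  exists T; split; first exact: num_real.
  move=> t tT; apply: EP => x; rewrite /= in_itv/= -ler_norml => xr.
  by apply: eE; rewrite /ball/= distrC; exact: Tu.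
apply: contrapT => /existsNP[U /not_implyP[oU /not_implyP[Uc /negP]]].
rewrite -leNgt => muU.
have /nbhs_ballP[d /= d0 cdU] : nbhs c U by exact: open_nbhs_nbhs.
pose A : set R := `[- M, M] `\` U.
have mU : measurable U by exact: open_measurable.
have mA : measurable A by apply: measurableD => //; exact: measurable_itv.
have AM : A `<=` `[- M, M] by exact: subDsetl.
have A0 : mu (~` A) = 0%E.
  rewrite /A setDE setCI setCK measureU0//.
  - by apply: measurableC; exact: measurable_itv.
  - by apply/eqP; rewrite -measure_le0.
have dA z : A z -> d <= `|z - c|.
  move=> [_]; apply: contra_notT; rewrite -ltNge => zd.
  by apply: cdU; rewrite /ball/= distrC.
pose k := d ^+ 2 / (1 + d).
have k0 : 0 < k by rewrite divr_gt0 ?exprn_gt0// addr_gt0.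
have := ucvg 2 (ltr0n _ 2).
have nb : nbhs (cst c : {uniform` `[- 2, 2] -> R})
    [set h : R -> R | forall x, `[- 2, 2]%classic x -> `|h x - c| < k].
  apply/uniform_nbhs; exists [set p | ball p.1 k p.2]; split.
    by rewrite -entourage_ballE; exists k.
  by move=> h hE x /hE; rewrite /ball/= distrC.
move=> /(_ _ nb) [T [_ HT]].
have tT : T - 1 < T by rewrite ltrBlDr ltrDl.
have u2 := HT _ tT 2 I2; have u2' := HT _ tT (- 2) I2'.
have := burgers_sol_gap mu M A c d _ mA AM A0 d0 dA u2.
by rewrite leNgt u2'.
Qed.
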